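(* Assume $\alpha=\{\alpha_n\}_{n\in\mathbb{Z}}\in\mathbb{D}^{\mathbb{Z}}$ satisfies $\|\alpha\|_\infty=\sup_n|\alpha_n|=r_0<1$. There is a constant $B_0$ such that the following is true: if $\alpha$ is $B$-reflective with $B>B_0$, then $\mathcal{E}_{\alpha,\rho}$ has empty point spectrum for any admissible choice of $\rho$, that is, any choice of $\rho=\{\rho_n\}\in\mathbb{C}^{\mathbb{Z}}$ satisfying $|\alpha_n|^2+|\rho_n|^2=1$ for all $n$; in particular, the standard CMV matrix $\mathcal{E}_\alpha=\mathcal{E}_{\alpha,\sqrt{1-|\alpha|^2}}$ has empty point spectrum.
   Context: $\mathbb{D}=\{z\in\mathbb{C}:|z|<1\}$. Given sequences $\alpha,\rho\in\mathbb{C}^{\mathbb{Z}}$ with $|\alpha_n|^2+|\rho_n|^2=1$ for all $n$, the generalized extended CMV (GECMV) matrix $\mathcal{E}_{\alpha,\rho}$ is the unitary operator on $\ell^2(\mathbb{Z})$ given by $$[\mathcal{E}_{\alpha,\rho}u](2n)=\overline{\alpha_{2n}}\big[\overline{\rho_{2n-1}}u(2n-1)-\alpha_{2n-1}u(2n)\big]+\rho_{2n}\big[\overline{\alpha_{2n+1}}u(2n+1)+\rho_{2n+1}u(2n+2)\big],$$ $$[\mathcal{E}_{\alpha,\rho}u](2n+1)=\overline{\rho_{2n}}\big[\overline{\rho_{2n-1}}u(2n-1)-\alpha_{2n-1}u(2n)\big]-\alpha_{2n}\big[\overline{\alpha_{2n+1}}u(2n+1)+\rho_{2n+1}u(2n+2)\big].$$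 The standard CMV matrix $\mathcal{E}_\alpha$ is the case $\rho_n=\sqrt{1-|\alpha_n|^2}$ for all $n$. Empty point spectrum means that the operator has no eigenvalues on $\ell^2(\mathbb{Z})$. For $\zeta\in\frac12\mathbb{Z}$, the reflection of a sequence $u\in\mathbb{C}^{\mathbb{Z}}$ through $\zeta$ is $(\mathcal{R}_\zeta u)_n=u_{2\zeta-n}$. Given $B>0$ and $\zeta\in\frac12\mathbb{Z}$, a sequence $\alpha\in\mathbb{D}^{\mathbb{Z}}$ is $(B,\zeta)$-reflective if $$\big|(\mathcal{R}_\zeta\alpha)_n-\overline{\alpha_n}\big|<e^{-B|\zeta|}\quad\text{for all } n\in\mathbb{Z}\text{ with }|\zeta-n|\le e^{B|\zeta|},$$ and $\alpha$ is $B$-reflective if it is $(B,\zeta)$-reflective for infinitely many $\zeta\in\frac12\mathbb{Z}$. *)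

(* Defs.v *)
From HB Require Import structures.
From mathcomp Require Import all_boot all_order all_algebra.
From mathcomp Require Import all_classical all_reals all_analysis.
From mathcomp Require Import complex.
From mathcomp Require Import zify.

Set Implicit Arguments.
Unset Strict Implicit.
Unset Printing Implicit Defensive.

Import Order.TTheory GRing.Theory Num.Theory.

Local Open Scope classical_set_scope.
Local Open Scope ring_scope.
Local Open Scope complex_scope.

(* The library norm on [R[i]] takes its values in [R[i]]; [cabs] is the modulus
   as an element of [R]. *)
Definition cabs (R : realType) (z : R[i]) : R := Normc.normc z.

Lemma cabsE (R : realType) (z : R[i]) : `|z| = (cabs z)%:C.
Proof. by []. Qed.

Definition l2Z (R : realType) : set (int -> R[i]) :=
  [set u | summable [set: int] (fun n => (cabs (u n) ^+ 2)%:E)].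

(* The defining formulas are local, so [gecmv] makes sense on all of C^Z; it is
   regarded as an operator on l^2(Z) in [point_spectrum] below. *)
Definition gecmv (R : realType) (alpha rho : int -> R[i]) (u : int -> R[i]) :
    int -> R[i] := fun m =>
  let n := (m %/ 2)%Z in
  let a := (rho (2 * n - 1))^* * u (2 * n - 1) - alpha (2 * n - 1) * u (2 * n) in
  let b := (alpha (2 * n + 1))^* * u (2 * n + 1) + rho (2 * n + 1) * u (2 * n + 2)
  in
  if (2 %| m)%Z then (alpha (2 * n))^* * a + rho (2 * n) * b
  else (rho (2 * n))^* * a - alpha (2 * n) * b.

Lemma gecmv_even (R : realType) (alpha rho u : int -> R[i]) (n : int) :
  gecmv alpha rho u (2 * n) =
    (alpha (2 * n))^* *
      ((rho (2 * n - 1))^* * u (2 * n - 1) - alpha (2 * n - 1) * u (2 * n)) +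
    rho (2 * n) *
      ((alpha (2 * n + 1))^* * u (2 * n + 1) + rho (2 * n + 1) * u (2 * n + 2)).
Proof.
have -> : 2 * n = n * 2 by rewrite mulrC.
by rewrite /gecmv mulzK// dvdz_mull// [2 * n]mulrC.
Qed.

Lemma gecmv_odd (R : realType) (alpha rho u : int -> R[i]) (n : int) :
  gecmv alpha rho u (2 * n + 1) =
    (rho (2 * n))^* *
      ((rho (2 * n - 1))^* * u (2 * n - 1) - alpha (2 * n - 1) * u (2 * n)) -
    alpha (2 * n) *
      ((alpha (2 * n + 1))^* * u (2 * n + 1) + rho (2 * n + 1) * u (2 * n + 2)).
Proof.
have hq : ((2 * n + 1) %/ 2)%Z = n by lia.
have hd : (2 %| 2 * n + 1)%Z = false by lia.
by rewrite /gecmv hq hd.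
Qed.

Definition admissible (R : realType) (alpha rho : int -> R[i]) : Prop :=
  forall n, cabs (alpha n) ^+ 2 + cabs (rho n) ^+ 2 = 1.

Definition cmv (R : realType) (alpha : int -> R[i]) :
    (int -> R[i]) -> int -> R[i] :=
  gecmv alpha (fun n => (Num.sqrt (1 - cabs (alpha n) ^+ 2))%:C).

Definition point_spectrum (R : realType)
    (E : (int -> R[i]) -> int -> R[i]) : set R[i] :=
  [set z | exists u : int -> R[i],
    [/\ l2Z u, exists n, u n != 0 & forall n, E u n = z * u n]].

(* A half-integer zeta is encoded by the integer [k = 2 * zeta]. *)
Definition half_integer (R : realType) (k : int) : R := k%:~R / 2.

Definition reflection (R : realType) (k : int) (u : int -> R[i]) :
    int -> R[i] := fun n => u (k - n).

Definition reflective_at (R : realType) (B : R) (k : int)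
    (alpha : int -> R[i]) : Prop :=
  let zeta := half_integer R k in
  forall n : int, `|zeta - n%:~R| <= expR (B * `|zeta|) ->
    cabs (reflection k alpha n - (alpha n)^*) < expR (- B * `|zeta|).

Definition reflective (R : realType) (B : R) (alpha : int -> R[i]) : Prop :=
  infinite_set [set k : int | reflective_at B k alpha].

(* Main.v *)
(* With z = om^2 and v the image of the eigenvector u under the odd blocks of
   the CMV matrix, a diagonal gauge turns the eigenvalue equation into the
   SU(1,1) recursion x_(n+1) = T_n x_n of [szego], x_n = (a_n, b_n), which
   depends on rho only through |rho|.  If alpha_(k-n) is the conjugate of
   alpha_n, the mirrored sequence y_n = (b_(k+1-n), - a_(k+1-n)) solves the same
   recursion; for a reflective alpha it does so up to an error
   e = exp (- B |k| / 2) on about 1 / e sites.  Hence the Wronskian of x and y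
   varies by O(e), and being summable over 1 / e sites it is itself O(e).  So at
   one of the mirror sites 0 and k+1 the vectors x and y are collinear up to
   O(e); propagating the relation p y = q x to the other site costs a factor
   C^|k|, which e absorbs when B is large.  There it reads
   a_0^2 + b_(k+1)^2 -> 0 and b_0^2 + a_(k+1)^2 -> 0.  As x_(k+1) -> 0 for
   square summable x, it follows that x_0 = 0. *)
Require Import Defs.
From mathcomp Require Import all_boot all_order all_algebra.
From mathcomp Require Import all_classical all_reals all_analysis.
From mathcomp Require Import complex.
From mathcomp Require Import zify ring lra.

Set Implicit Arguments.
Unset Strict Implicit.
Unset Printing Implicit Defensive.

Import Order.TTheory GRing.Theory Num.Theory.

Local Open Scope classical_set_scope.
(* [ring_scope] comes last so that [^*] is [Num.conj] everywhere below. *)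
Local Open Scope complex_scope.
Local Open Scope ring_scope.

(** * Modulus and conjugation of complex numbers *)

Lemma cabs_ge0 (R : realType) (z : R[i]) : 0 <= cabs z.
Proof. by rewrite -lecR -cabsE normr_ge0. Qed.

Lemma cabsM (R : realType) (x y : R[i]) : cabs (x * y) = cabs x * cabs y.
Proof. exact: Normc.normcM. Qed.

Lemma le_cabsD (R : realType) (x y : R[i]) : cabs (x + y) <= cabs x + cabs y.
Proof. exact: le_normcD. Qed.

Lemma cabsN (R : realType) (x : R[i]) : cabs (- x) = cabs x.
Proof. exact: normcN. Qed.

Lemma le_cabsB (R : realType) (x y : R[i]) : cabs (x - y) <= cabs x + cabs y.
Proof. by rewrite (le_trans (le_cabsD _ _))// cabsN. Qed.

Lemma cabs0 (R : realType) : cabs (0 : R[i]) = 0.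
Proof. exact: Normc.normc0. Qed.

Lemma cabs0_eq0 (R : realType) (x : R[i]) : cabs x = 0 -> x = 0.
Proof. exact: Normc.eq0_normc. Qed.

Lemma cabsJ (R : realType) (x : R[i]) : cabs x^* = cabs x.
Proof. by have /complexI := normcJ x. Qed.

Lemma cabs_real (R : realType) (x : R) : 0 <= x -> cabs x%:C = x.
Proof. by move=> x0; rewrite /cabs /= expr0n/= addr0 sqrtr_sqr ger0_norm. Qed.

Lemma sqr_cabs (R : realType) (z : R[i]) : (cabs z ^+ 2)%:C = z * z^*.
Proof. by rewrite -sqr_normc cabsE rmorphXn. Qed.

Lemma conj_real (R : realType) (x : R) : (x%:C)^* = x%:C.
Proof. exact: conjc_real. Qed.

Lemma conjD (R : realType) (x y : R[i]) : (x + y)^* = x^* + y^*.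
Proof. exact: rmorphD. Qed.

Lemma conjB (R : realType) (x y : R[i]) : (x - y)^* = x^* - y^*.
Proof. exact: rmorphB. Qed.

Lemma conjM (R : realType) (x y : R[i]) : (x * y)^* = x^* * y^*.
Proof. exact: rmorphM. Qed.

(** * The normalizing factor of a transfer matrix *)

(** For an admissible pair this is [1 / |rho|]; writing it through [al] alone keeps the phase of
    [rho] out of the recursion. *)
Definition cfac (R : realType) (al : R[i]) : R :=
  (Num.sqrt (1 - cabs al ^+ 2))^-1.

Lemma cfac_sqr (R : realType) (al : R[i]) : cabs al < 1 ->
  cfac al ^+ 2 * (1 - cabs al ^+ 2) = 1.
Proof.
move=> h; have h0 := cabs_ge0 al.
have p : 0 < 1 - cabs al ^+ 2 by nra.
by rewrite /cfac exprVn sqr_sqrtr ?ltW// mulVf// gt_eqF.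
Qed.

Lemma cfac_ge0 (R : realType) (al : R[i]) : 0 <= cfac al.
Proof. by rewrite invr_ge0 sqrtr_ge0. Qed.

Lemma cfac_ge1 (R : realType) (al : R[i]) : cabs al < 1 -> 1 <= cfac al.
Proof. by move=> /cfac_sqr h; have := cfac_ge0 al; nra. Qed.

Lemma cfac_le (R : realType) (r : R) (al : R[i]) : cabs al <= r -> r < 1 ->
  cfac al * (1 - r) <= 1.
Proof.
move=> h r1; have h0 := cabs_ge0 al.
have h1 : cabs al < 1 by lra.
have := cfac_sqr h1; have := cfac_ge1 h1.
move: (cfac al) (cabs al) h h0 h1 => c m h h0 h1 c1 e.
suff : c * (1 - m) <= 1 by nra.
have : c * (1 - m) <= c ^+ 2 * (1 - m ^+ 2) by rewrite ler_pM//; nra.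
by rewrite e.
Qed.

(** With [c], [c'] the factors and [m], [m'] the moduli, [c ^+ 2 - c' ^+ 2 = (c * c') ^+ 2 * (m ^+ 2
    - m' ^+ 2)]. The power [(1 - r) ^+ 4] absorbs [(c * c') ^+ 2], and [m + m' <= 2 <= c + c']
    removes the sums. *)
Lemma cfac_dist (R : realType) (r e : R) (al be : R[i]) :
  cabs al <= r -> cabs be <= r -> r < 1 -> cabs (al - be) <= e ->
  `|cfac al - cfac be| * (1 - r) ^+ 4 <= e.
Proof.
move=> ha hb r1 he.
have ha0 := cabs_ge0 al; have hb0 := cabs_ge0 be.
have e0 : 0 <= e by exact: le_trans (cabs_ge0 _) he.
have e1 : `|cabs al - cabs be| <= e.
  rewrite ler_norml; apply/andP; split.
    have := le_cabsD al (be - al); rewrite addrC subrK -opprB cabsN; lra.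
  have := le_cabsD be (al - be); rewrite addrC subrK; lra.
have a1 : cabs al < 1 by lra.
have b1 : cabs be < 1 by lra.
have sa := cfac_sqr a1; have sb := cfac_sqr b1.
have ga := cfac_ge1 a1; have gb := cfac_ge1 b1.
have la := cfac_le ha r1; have lb := cfac_le hb r1.
move: (cfac al) (cfac be) sa sb ga gb la lb => c c' sa sb ga gb la lb.
move: (cabs al) (cabs be) ha hb ha0 hb0 e1 a1 b1 sa sb =>
  m m' ha hb ha0 hb0 e1 a1 b1 sa sb.
have hd : (c - c') * (c + c') = (c * c') ^+ 2 * ((m - m') * (m + m')).
  have -> : (c - c') * (c + c') =
    c ^+ 2 * (c' ^+ 2 * (1 - m' ^+ 2)) - c' ^+ 2 * (c ^+ 2 * (1 - m ^+ 2)).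
    by rewrite sa sb; ring.
  by ring.
have dc : 0 <= c * (1 - r) by rewrite mulr_ge0//; lra.
have dc' : 0 <= c' * (1 - r) by rewrite mulr_ge0//; lra.
have l1 : (c * c') ^+ 2 * (1 - r) ^+ 4 <= 1.
  have -> : (c * c') ^+ 2 * (1 - r) ^+ 4 =
    (c * (1 - r)) ^+ 2 * (c' * (1 - r)) ^+ 2 by ring.
  by apply: mulr_ile1; rewrite ?sqr_ge0// expr_le1.
have d0 : 0 <= (1 - r) ^+ 4 by rewrite exprn_ge0//; lra.
have : `|c - c'| * (c + c') * (1 - r) ^+ 4 <= e * (m + m').
  have -> : `|c - c'| * (c + c') = (c * c') ^+ 2 * (`|m - m'| * (m + m')).
    have := congr1 (fun x => `|x|) hd.
    have p1 : 0 <= c + c' by lra.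
    have p2 : 0 <= m + m' by lra.
    rewrite [`|(c - c') * _|]normrM (ger0_norm p1) [X in _ = X -> _]normrM.
    by rewrite (ger0_norm (sqr_ge0 _)) [`|_ * (m + m')|]normrM (ger0_norm p2).
  rewrite mulrAC -[leRHS]mul1r ler_pM//.
  - by rewrite mulr_ge0// sqr_ge0.
  - by rewrite mulr_ge0//; lra.
  - by rewrite ler_wpM2r//; lra.
have p : 0 <= `|c - c'| * (1 - r) ^+ 4 by rewrite mulr_ge0.
rewrite [X in X <= _]mulrAC; move: p; set x := _ * _ ^+ 4.
by nra.
Qed.

(** * Transfer matrices *)

Definition nrm (R : realType) (x : R[i] * R[i]) : R := cabs x.1 + cabs x.2.

Definition wronskian (R : realType) (x y : R[i] * R[i]) : R[i] :=
  x.1 * y.2 - x.2 * y.1.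

Definition szego (R : realType) (om al : R[i]) (x : R[i] * R[i]) :
    R[i] * R[i] :=
  ((cfac al)%:C * (om^* * x.1 - al * x.2),
   (cfac al)%:C * (om * x.2 - al^* * x.1)).

Lemma nrm_ge0 (R : realType) (x : R[i] * R[i]) : 0 <= nrm x.
Proof. by rewrite addr_ge0// cabs_ge0. Qed.

Lemma wronskian_le (R : realType) (x y : R[i] * R[i]) :
  cabs (wronskian x y) <= nrm x * nrm y.
Proof.
rewrite (le_trans (le_cabsB _ _))// !cabsM /nrm.
have := (cabs_ge0 x.1, cabs_ge0 x.2, (cabs_ge0 y.1, cabs_ge0 y.2)).
by move=> [[? ?] [? ?]]; nra.
Qed.

Lemma unimodular_conjM (R : realType) (om : R[i]) : cabs om = 1 ->
  om * om^* = 1.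
Proof. by move=> h; rewrite -sqr_cabs h expr1n. Qed.

Lemma cfac_conjM (R : realType) (al : R[i]) : cabs al < 1 ->
  (cfac al)%:C ^+ 2 * (1 - al * al^*) = 1.
Proof.
move=> h; rewrite -sqr_cabs -rmorphXn -[X in X - _](rmorph1 (real_complex R)).
by rewrite -rmorphB -rmorphM cfac_sqr.
Qed.

(** The Wronskian is a 2x2 determinant, and the transfer matrix has determinant one. *)
Lemma wronskian_szego (R : realType) (om al : R[i]) (x y : R[i] * R[i]) :
  cabs om = 1 -> cabs al < 1 ->
  wronskian (szego om al x) (szego om al y) = wronskian x y.
Proof.
move=> /unimodular_conjM ho /cfac_conjM hc; rewrite /wronskian /=.
transitivity ((cfac al)%:C ^+ 2 * (om * om^* - al * al^*) *
  (x.1 * y.2 - x.2 * y.1)); first by ring.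
by rewrite ho hc mul1r.
Qed.

(** One constant bounds both the norm of a transfer matrix and its Lipschitz dependence on [al]; the
    latter dictates the fourth power. *)
Definition szego_const (R : realType) (r : R) : R := 4 / (1 - r) ^+ 4.

Lemma szego_const_ge4 (R : realType) (r : R) : 0 <= r -> r < 1 ->
  4 <= szego_const r.
Proof.
move=> r0 r1; rewrite /szego_const ler_pdivlMr ?exprn_gt0//; last by lra.
rewrite -[leRHS]mulr1 ler_wpM2l// expr_le1//; lra.
Qed.

Lemma le_szego_const (R : realType) (r x : R) : r < 1 ->
  x * (1 - r) ^+ 4 <= 4 -> x <= szego_const r.
Proof.
by move=> r1 h; rewrite /szego_const ler_pdivlMr ?exprn_gt0//; lra.
Qed.

Lemma cfac_le4 (R : realType) (r : R) (al : R[i]) : cabs al <= r -> r < 1 ->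
  cfac al * (1 - r) ^+ 4 <= 1.
Proof.
move=> h r1; have h0 := cabs_ge0 al; have c0 := cfac_ge0 al.
rewrite exprS mulrA mulr_ile1 ?cfac_le//.
- by rewrite mulr_ge0//; lra.
- by rewrite exprn_ge0//; lra.
- by rewrite expr_le1//; lra.
Qed.

Lemma nrm_szego (R : realType) (r : R) (om al : R[i]) (x : R[i] * R[i]) :
  cabs om = 1 -> cabs al <= r -> r < 1 ->
  nrm (szego om al x) <= szego_const r * nrm x.
Proof.
move=> ho ha r1; have ha0 := cabs_ge0 al.
have := (cabs_ge0 x.1, cabs_ge0 x.2) => -[x1 x2].
have c0 := cfac_ge0 al.
have cK : 2 * cfac al <= szego_const r.
  by apply: le_szego_const => //; have := cfac_le4 ha r1; lra.
apply: (@le_trans _ _ (2 * cfac al * nrm x)); last first.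
  by rewrite ler_wpM2r// nrm_ge0.
have -> : 2 * cfac al * nrm x = cfac al * nrm x + cfac al * nrm x by ring.
rewrite /nrm /= !cabsM cabs_real// lerD// ler_wpM2l//.
  by rewrite (le_trans (le_cabsB _ _))// !cabsM cabsJ ho; nra.
by rewrite (le_trans (le_cabsB _ _))// !cabsM cabsJ ho; nra.
Qed.

Lemma nrm_szegoB (R : realType) (r e : R) (om al be : R[i])
    (x : R[i] * R[i]) :
  cabs om = 1 -> cabs al <= r -> cabs be <= r -> r < 1 ->
  cabs (al - be) <= e ->
  nrm (szego om al x - szego om be x) <= szego_const r * e * nrm x.
Proof.
move=> ho ha hb r1 he.
have ha0 := cabs_ge0 al.
have e0 : 0 <= e by exact: le_trans (cabs_ge0 _) he.
have := (cabs_ge0 x.1, cabs_ge0 x.2) => -[x1 x2].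
have D := cfac_dist ha hb r1 he.
have cb := cfac_le4 hb r1.
have b0 := cfac_ge0 be.
have n0 := normr_ge0 (cfac al - cfac be).
set D1 := `|cfac al - cfac be| in D n0.
have hC (t : R) : cabs t%:C = `|t|.
  by rewrite /cabs /= expr0n/= addr0 sqrtr_sqr.
(* [M] dominates the change of every matrix entry, diagonal or not; the two rows together give
   [2 * M]. *)
set M := D1 + cfac be * e.
have d4 : 0 <= (1 - r) ^+ 4 by rewrite exprn_ge0//; lra.
have K2 : 2 * M <= szego_const r * e.
  rewrite /szego_const mulrAC ler_pdivlMr ?exprn_gt0//; last by lra.
  by rewrite /M; nra.
have M1 : D1 <= M by rewrite /M lerDl mulr_ge0.
have M2 : cabs ((cfac al)%:C * al - (cfac be)%:C * be) <= M.
  have -> : (cfac al)%:C * al - (cfac be)%:C * be =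
    (cfac al - cfac be)%:C * al + (cfac be)%:C * (al - be).
    by rewrite rmorphB/=; ring.
  rewrite (le_trans (le_cabsD _ _))// !cabsM hC cabs_real//.
  by rewrite lerD// ?ler_wpM2l// -[leRHS]mulr1 ler_wpM2l//; lra.
have M2' : cabs ((cfac al)%:C * al^* - (cfac be)%:C * be^*) <= M.
  have <- : ((cfac al)%:C * al - (cfac be)%:C * be)^* =
      (cfac al)%:C * al^* - (cfac be)%:C * be^*.
    by rewrite conjB !conjM !conj_real.
  by rewrite cabsJ.
have M0 : 0 <= M by exact: le_trans n0 M1.
apply: (@le_trans _ _ (2 * M * nrm x)); last by rewrite ler_wpM2r// nrm_ge0.
have -> : 2 * M * nrm x = M * nrm x + M * nrm x by ring.
rewrite /nrm /= lerD//.
  have -> : (cfac al)%:C * (om^* * x.1 - al * x.2) -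
      (cfac be)%:C * (om^* * x.1 - be * x.2) =
    (cfac al - cfac be)%:C * om^* * x.1 -
    ((cfac al)%:C * al - (cfac be)%:C * be) * x.2 by rewrite rmorphB/=; ring.
  rewrite (le_trans (le_cabsB _ _))// !cabsM cabsJ ho hC mulr1 mulrDr.
  by rewrite lerD// ler_wpM2r.
have -> : (cfac al)%:C * (om * x.2 - al^* * x.1) -
    (cfac be)%:C * (om * x.2 - be^* * x.1) =
  (cfac al - cfac be)%:C * om * x.2 -
  ((cfac al)%:C * al^* - (cfac be)%:C * be^*) * x.1 by rewrite rmorphB/=; ring.
rewrite (le_trans (le_cabsB _ _))// !cabsM ho hC mulr1.
by rewrite addrC mulrDr lerD// ler_wpM2r.
Qed.

Lemma nrmD (R : realType) (x y : R[i] * R[i]) :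
  nrm (x + y) <= nrm x + nrm y.
Proof. by rewrite /nrm /= addrACA lerD// le_cabsD. Qed.

Lemma wronskianB (R : realType) (x y y' : R[i] * R[i]) :
  wronskian x (y - y') = wronskian x y - wronskian x y'.
Proof. by rewrite /wronskian /=; ring. Qed.

(* Near constancy bounds [W_0] by [W_m] up to O(e S); averaging over the
   [M.+1 >= 1 / e] values of [m], whose [W_m] have total at most [S], yields
   another O(e S). *)
Lemma wronskian_small (R : realType) (r e S : R) (om : R[i])
    (al be : nat -> R[i]) (x y : nat -> R[i] * R[i]) (M : nat) :
  0 <= r -> r < 1 -> cabs om = 1 ->
  (forall j, cabs (al j) <= r) -> (forall j, cabs (be j) <= r) ->
  (forall j, x j.+1 = szego om (al j) (x j)) ->
  (forall j, y j.+1 = szego om (be j) (y j)) ->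
  (forall j, (j < M)%N -> cabs (al j - be j) <= e) ->
  (forall m, \sum_(j < m) nrm (x j) * nrm (y j) <= S) ->
  0 <= e -> 1 <= M.+1%:R * e ->
  cabs (wronskian (x 0%N) (y 0%N)) <= 2 * szego_const r ^+ 2 * S * e.
Proof.
move=> r0 r1 ho ha hb hx hy hab hS e0 hM.
have K4 := szego_const_ge4 r0 r1.
set K := szego_const r in K4 *.
have S0 : 0 <= S by have := hS 0%N; rewrite big_ord0.
pose P j := nrm (x j) * nrm (y j).
have P0 j : 0 <= P j by rewrite mulr_ge0// nrm_ge0.
pose W j := wronskian (x j) (y j).
have hW m : (m <= M)%N ->
    cabs (W 0%N) <= cabs (W m) + K ^+ 2 * e * \sum_(j < m) P j.
  elim: m => [|m IH] hm; first by rewrite big_ord0 mulr0 addr0.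
  rewrite big_ord_recr/= mulrDr.
  apply: (le_trans (IH (ltnW hm))).
  suff : cabs (W m) <= cabs (W m.+1) + K ^+ 2 * e * P m.
    by move: (K ^+ 2 * e * \sum_(j < m) P j) (K ^+ 2 * e * P m) => u v; lra.
  (* The step with [al m] preserves the Wronskian, so [W] changes only by the defect of [y], which
     moves with [be m] instead. *)
  have -> : W m = W m.+1 + wronskian (x m.+1)
      (szego om (al m) (y m) - szego om (be m) (y m)).
    rewrite wronskianB {1}hx wronskian_szego//; last first.
      exact: le_lt_trans (ha m) r1.
    by rewrite /W -hy; ring.
  rewrite (le_trans (le_cabsD _ _))// lerD2l (le_trans (wronskian_le _ _))//.
  have -> : K ^+ 2 * e * P m = (K * nrm (x m)) * (K * e * nrm (y m)).
    by rewrite /P; ring.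
  by rewrite ler_pM ?nrm_ge0// ?hx ?nrm_szego// nrm_szegoB// hab.
have hW' m : (m <= M)%N -> cabs (W 0%N) <= P m + K ^+ 2 * e * S.
  move=> hm; apply: (le_trans (hW m hm)); apply: lerD.
    exact: wronskian_le.
  by apply: ler_wpM2l; [rewrite mulr_ge0 ?sqr_ge0|exact: hS].
have : M.+1%:R * cabs (W 0%N) <= S + M.+1%:R * (K ^+ 2 * e * S).
  have cst (t : R) : M.+1%:R * t = \sum_(m < M.+1) t.
    by rewrite sumr_const card_ord mulr_natl.
  rewrite !cst.
  apply: (@le_trans _ _ (\sum_(m < M.+1) (P m + K ^+ 2 * e * S))).
    by apply: ler_sum => m _; apply: hW'; rewrite -ltnS.
  by rewrite big_split/= lerD2r hS.
set N := M.+1%:R => h.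
have N0 : 0 < N by rewrite ltr0n.
(* By [1 <= N * e] the lone [S] is at most [N * (e * S)], after which [N] cancels. *)
have : N * cabs (W 0%N) <= N * (e * S + K ^+ 2 * e * S).
  rewrite mulrDr (le_trans h)// lerD2r mulrA -[leLHS]mul1r ler_wpM2r//.
rewrite ler_pM2l// => /le_trans; apply.
have eS : 0 <= e * S by rewrite mulr_ge0.
have K1 : 1 <= K ^+ 2 by nra.
move: eS; rewrite -mulrA [e * S]mulrC -[_ * S * e]mulrA; set u := S * e.
by move: K1; set k := K ^+ 2; nra.
Qed.

(** If [p] and [q] are the first, or the second, coordinates of [x] and [y], one entry vanishes and
    the other is the Wronskian up to sign: the size of this vector measures the failure of
    collinearity. *)
Definition comb (R : realType) (p q : R[i]) (x y : R[i] * R[i]) :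
  R[i] * R[i] := (p * y.1 - q * x.1, p * y.2 - q * x.2).

(** By linearity [p y - q x] follows the recursion of [x] up to [p] times the defect of [y]. A step
    multiplies the norm by at most [szego_const r] and adds at most [szego_const r * X]; doubling
    the base absorbs the added term. *)
Lemma comb_szego_le (R : realType) (r e X : R) (om : R[i])
    (al be : nat -> R[i]) (x y : nat -> R[i] * R[i]) (L : nat) (p q : R[i]) :
  0 <= r -> r < 1 -> cabs om = 1 ->
  (forall j, cabs (al j) <= r) -> (forall j, cabs (be j) <= r) ->
  (forall j, x j.+1 = szego om (al j) (x j)) ->
  (forall j, y j.+1 = szego om (be j) (y j)) ->
  (forall j, (j < L)%N -> cabs (al j - be j) <= e) ->
  (forall j, cabs p * nrm (y j) * e <= X) ->
  nrm (comb p q (x 0%N) (y 0%N)) <= X ->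
  nrm (comb p q (x L) (y L)) <= (2 * szego_const r) ^+ L * X.
Proof.
move=> r0 r1 ho ha hb hx hy hab hX h0.
have K4 := szego_const_ge4 r0 r1.
set K := szego_const r in K4 *.
have X0 : 0 <= X by exact: le_trans (nrm_ge0 _) h0.
elim: L hab => [|L IH] hab; first by rewrite expr0 mul1r.
have {}IH : nrm (comb p q (x L) (y L)) <= (2 * K) ^+ L * X.
  by apply: IH => j jL; apply: hab; exact: ltnW.
have c0 := cabs_ge0 p.
set D := szego om (be L) (y L) - szego om (al L) (y L).
have -> : comb p q (x L.+1) (y L.+1) =
    szego om (al L) (comb p q (x L) (y L)) + (p * D.1, p * D.2).
  by apply: injective_projections; rewrite /comb hx hy /D /=; ring.
have hD : nrm (p * D.1, p * D.2) = cabs p * nrm D.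
  by rewrite /nrm [LHS]/= !cabsM -mulrDr.
apply: (le_trans (nrmD _ _)); rewrite hD.
have hD1 : cabs p * nrm D <= K * X.
  have : nrm D <= K * e * nrm (y L).
    by apply: nrm_szegoB => //; rewrite -opprB cabsN hab.
  move=> /(ler_wpM2l c0) /le_trans; apply.
  have -> : cabs p * (K * e * nrm (y L)) = K * (cabs p * nrm (y L) * e).
    by ring.
  by rewrite ler_wpM2l//; lra.
have hD2 : nrm (szego om (al L) (comb p q (x L) (y L))) <=
    K * ((2 * K) ^+ L * X).
  apply: (le_trans (nrm_szego _ ho (ha L) r1)).
  by rewrite -/K ler_wpM2l//; lra.
have p1 : 1 <= (2 * K) ^+ L by rewrite exprn_ege1//; lra.
have : K * X <= K * ((2 * K) ^+ L * X).
  by rewrite ler_wpM2l ?ler_peMl//; lra.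
by rewrite exprS; move: (nrm _) (_ * nrm _) hD1 hD2 => u v; nra.
Qed.

Lemma cfacJ (R : realType) (al : R[i]) : cfac al^* = cfac al.
Proof. by rewrite /cfac cabsJ. Qed.

(** * Mirrored solutions *)

(** The coefficient [al n] links the sites [n] and [n + 1], so reflecting coefficients by
    [n -> k - n] reflects sites by [n -> k + 1 - n]. *)
Definition mirror (R : realType) (k : int) (z : int -> R[i] * R[i]) (n : int) :
  R[i] * R[i] := ((z (k + 1 - n)).2, - (z (k + 1 - n)).1).

Lemma nrm_mirror (R : realType) (k : int) (z : int -> R[i] * R[i]) (n : int) :
  nrm (mirror k z n) = nrm (z (k + 1 - n)).
Proof. by rewrite /nrm /= cabsN addrC. Qed.

(** Reflection replaces a transfer matrix by its inverse, which is its adjugate; the quarter turn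
    [(a, b) -> (b, - a)] conjugates this adjugate into the transfer matrix of the conjugate
    coefficient. *)
Lemma mirror_szego (R : realType) (om : R[i]) (al : int -> R[i])
    (z : int -> R[i] * R[i]) (k n : int) :
  cabs om = 1 -> (forall n, cabs (al n) < 1) ->
  (forall n, z (n + 1) = szego om (al n) (z n)) ->
  mirror k z (n + 1) = szego om (al (k - n))^* (mirror k z n).
Proof.
move=> ho ha hz; rewrite /mirror.
have -> : k + 1 - (n + 1) = k - n by lia.
have -> : k + 1 - n = k - n + 1 by lia.
rewrite hz /szego /= cfacJ conjCK.
have := unimodular_conjM ho; have := cfac_conjM (ha (k - n)).
move: (al (k - n)) (z (k - n)) => a [z1 z2] /= hc h1.
congr pair.
  transitivity ((cfac a)%:C ^+ 2 * (om * om^* - a * a^*) * z2); last by ring.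
  by rewrite h1 hc mul1r.
transitivity ((cfac a)%:C ^+ 2 * (om * om^* - a * a^*) * - z1); last by ring.
by rewrite h1 hc mul1r.
Qed.

(** * Families with uniformly bounded finite sums *)

Definition sums_le (R : realType) (I : eqType) (f : I -> R) (S : R) : Prop :=
  forall s : seq I, uniq s -> \sum_(n <- s) f n <= S.

Lemma sums_le_inj (R : realType) (I J : eqType) (f : I -> R) (S : R)
    (h : J -> I) : injective h -> sums_le f S -> sums_le (f \o h) S.
Proof.
move=> hi hf s us; have := hf (map h s).
by rewrite map_inj_uniq// big_map; apply.
Qed.

Lemma sums_le_ord (R : realType) (f : nat -> R) (S : R) (m : nat) :
  sums_le f S -> \sum_(j < m) f j <= S.
Proof. by move=> hf; rewrite -(big_mkord predT) hf// iota_uniq. Qed.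

Lemma sums_le1 (R : realType) (I : eqType) (f : I -> R) (S : R) (n : I) :
  sums_le f S -> f n <= S.
Proof. by move=> /(_ [:: n] isT); rewrite big_seq1. Qed.

(** The sites [i] and [i + L] are mirror images, so the mirrored solution at either one is made of
    [z] at the other. Approximate collinearity at [i], transported over [L] steps, thus becomes a
    relation between these two vectors alone. *)
Lemma reflection_estimate (R : realType) (r e S : R) (om : R[i])
    (al : int -> R[i]) (z : int -> R[i] * R[i]) (k i : int) (L M : nat) :
  0 <= r -> r < 1 -> cabs om = 1 -> (forall n, cabs (al n) <= r) ->
  (forall n, z (n + 1) = szego om (al n) (z n)) ->
  sums_le (fun n => nrm (z n) ^+ 2) S ->
  k + 1 = i + (i + L%:Z) ->
  (forall j : nat, (j < maxn L M)%N ->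
    cabs (al (i + j%:Z) - (al (k - (i + j%:Z)))^*) <= e) ->
  0 <= e -> 1 <= M.+1%:R * e ->
  let X := (2 * szego_const r) ^+ L * (2 * szego_const r ^+ 2 * S * e) in
  cabs ((z i).1 ^+ 2 + (z (i + L%:Z)).2 ^+ 2) <= X /\
  cabs ((z i).2 ^+ 2 + (z (i + L%:Z)).1 ^+ 2) <= X.
Proof.
move=> r0 r1 ho ha hz hS hk hal e0 hM; set T := 2 * _ * S * e; move=> X.
have ha1 n : cabs (al n) < 1 by exact: le_lt_trans (ha n) r1.
pose x (j : nat) := z (i + j%:Z).
pose y (j : nat) := mirror k z (i + j%:Z).
pose a (j : nat) := al (i + j%:Z).
pose b (j : nat) := (al (k - (i + j%:Z)))^*.
have iS (j : nat) : i + j.+1%:Z = i + j%:Z + 1 by lia.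
have hx j : x j.+1 = szego om (a j) (x j) by rewrite /x iS hz.
have hy j : y j.+1 = szego om (b j) (y j).
  by rewrite /y iS (mirror_szego _ _ ho ha1 hz).
have hb j : cabs (b j) <= r by rewrite /b cabsJ.
have K4 := szego_const_ge4 r0 r1.
have S0 : 0 <= S by have := hS [::] isT; rewrite big_nil.
have hn u v : nrm (z u) * nrm (z v) <= S.
  have := (sums_le1 u hS, sums_le1 v hS) => -[] /=.
  by have := (nrm_ge0 (z u), nrm_ge0 (z v)) => -[? ?]; nra.
have hxy m : \sum_(j < m) nrm (x j) * nrm (y j) <= S.
  have h1 := @sums_le_ord _ _ S m (sums_le_inj
    (h := fun j : nat => i + j%:Z) (fun u v e => ltac:(lia)) hS).
  have h2 := @sums_le_ord _ _ S m (sums_le_inj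
    (h := fun j : nat => k + 1 - (i + j%:Z)) (fun u v e => ltac:(lia)) hS).
  (* Uses [2 u v <= u ^+ 2 + v ^+ 2]; both families of squares are injective reindexings of the one
     bounded by [S]. *)
  rewrite -(ler_pM2l (_ : 0 < 2))// [leRHS]mulr_natl mulr2n.
  apply: le_trans (lerD h1 h2); rewrite -big_split/= mulr_sumr.
  apply: ler_sum => j _; rewrite nrm_mirror.
  by move: (nrm _) (nrm _) => u v; have := sqr_ge0 (u - v); nra.
have W := wronskian_small r0 r1 ho (fun j => ha (i + j%:Z)) hb hx hy
  (fun j jM => hal j (leq_trans jM (leq_maxr _ _))) hxy e0 hM : _ <= T.
(* Lets [T] also bound the defect terms [cabs p * nrm (y j) * e] during propagation. *)
have T0 : S * e <= T.
  rewrite /T -[leRHS]mulrA ler_peMl ?mulr_ge0//; nra.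
have E0 : k + 1 - i = i + L%:Z by lia.
have EL : k + 1 - (i + L%:Z) = i by lia.
have key p q : cabs p <= nrm (z i) ->
    nrm (comb p q (x 0%N) (y 0%N)) <= T -> nrm (comb p q (x L) (y L)) <= X.
  move=> hp; apply: (comb_szego_le r0 r1 ho (fun j => ha (i + j%:Z)) hb hx hy).
    by move=> j jL; apply: hal; exact: leq_trans jL (leq_maxl _ _).
  move=> j; apply: le_trans T0; rewrite ler_wpM2r// /y nrm_mirror.
  by apply: le_trans (hn i (k + 1 - (i + j%:Z))); rewrite ler_wpM2r// nrm_ge0.
have x0 : x 0%N = z i by rewrite /x addr0.
have y0 : y 0%N = ((z (i + L%:Z)).2, - (z (i + L%:Z)).1).
  by rewrite /y addr0 /mirror E0.
have xL : x L = z (i + L%:Z) by [].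
have yL : y L = ((z i).2, - (z i).1) by rewrite /y /mirror EL.
rewrite x0 y0 /wronskian /= in W.
rewrite x0 y0 xL yL /comb /nrm /= in key.
move: (z i) (z (i + L%:Z)) W key => [u1 u2] [v1 v2] /= W key.
have g1 := cabs_ge0 u1; have g2 := cabs_ge0 u2.
split.
  (* Here [p], [q] are the first coordinates of [x 0] and [y 0]; the second coordinates give the
     other estimate. *)
  have := key u1 v2; rewrite lerDl => /(_ g2).
  have -> : u1 * v2 - v2 * u1 = 0 by ring.
  have -> : u1 * - v1 - v2 * u2 = u1 * - v1 - u2 * v2 by ring.
  rewrite cabs0 add0r => /(_ W); apply: le_trans.
  have -> : u1 * - u1 - v2 * v2 = - (u1 ^+ 2 + v2 ^+ 2) by ring.
  by rewrite cabsN lerDr cabs_ge0.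
have := key u2 (- v1); rewrite lerDr => /(_ g1).
have -> : u2 * - v1 - - v1 * u2 = 0 by ring.
have -> : u2 * v2 - - v1 * u1 = - (u1 * - v1 - u2 * v2) by ring.
rewrite cabs0 addr0 cabsN => /(_ W); apply: le_trans.
have -> : u2 * u2 - - v1 * v1 = u2 ^+ 2 + v1 ^+ 2 by ring.
by rewrite lerDl cabs_ge0.
Qed.

(** * Choice of the reflection centre *)

(** Chebyshev: more than [S / d] such points would push a finite sum above [S]. *)
Lemma sums_le_finite (R : realType) (I : choiceType) (f : I -> R) (S d : R) :
  0 < d -> sums_le f S -> finite_set [set n | d <= f n].
Proof.
move=> d0 hS; apply: contrapT => /infinite_set_fset hinf.
have [B hB] := hinf (Num.truncn (S / d)).+1.
set s := finmap.enum_fset B => cB.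
have us : uniq s by exact: finmap.fset_uniq.
have : (size s)%:R * d <= S.
  apply: le_trans (hS _ us); rewrite mulr_natl.
  rewrite -[size s]count_predT -iter_addr_0 -big_const_seq big_seq.
  by rewrite [leRHS]big_seq; apply: ler_sum => n /hB.
rewrite -ler_pdivlMr// leNgt => /negP; apply.
by apply: lt_le_trans (Num.Theory.truncnS_gt _) _; rewrite ler_nat.
Qed.

(** The radius [exp (B |k| / 2)] dominates [|k| / 2], which covers the sites between the mirror
    pair. For the first [M] sites, [i] exceeds the centre by at most one half, and [j <= M - 1]
    leaves room for that. *)
Lemma reflective_at_near (R : realType) (B : R) (k i : int) (L M : nat)
    (al : int -> R[i]) (j : nat) :
  1 <= B -> reflective_at B k al -> i * 2 <= k + 1 -> k - i * 2 <= `|k| ->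
  (i + L%:Z) * 2 <= k + 2 + `|k| ->
  M%:R <= expR (B * `|half_integer R k|) -> (j < maxn L M)%N ->
  cabs (al (i + j%:Z) - (al (k - (i + j%:Z)))^*) <=
    expR (- B * `|half_integer R k|).
Proof.
move=> B1 hk h1 h2 h3 hM hj.
have -> : al (i + j%:Z) - (al (k - (i + j%:Z)))^* =
    (- (al (k - (i + j%:Z)) - (al (i + j%:Z))^*))^*.
  by rewrite opprB conjB conjCK.
rewrite cabsJ cabsN ltW//; apply: hk.
move: hM; rewrite /half_integer; set H := expR _ => hM.
have hH : `|k%:~R / 2 : R| <= H.
  have := expR_ge1Dx (B * `|k%:~R / 2|); rewrite -/H.
  by have := normr_ge0 (k%:~R / 2 : R); nra.
have cast (u v : int) : u <= v -> u%:~R <= v%:~R :> R by rewrite ler_int.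
move: hH; rewrite normrM -intr_norm normfV (ger0_norm (_ : 0 <= 2))// => hH.
move: h1 h2 h3 => /cast h1 /cast h2 /cast h3.
move: hH h1 h2 h3; rewrite !(intrD, intrM, mulrNz) -!pmulrn => hH h1 h2 h3.
move: hj; rewrite leq_max => /orP hj.
rewrite ler_norml; apply/andP.
have j0 : 0 <= j%:R :> R by exact: ler0n.
by case: hj; rewrite -(ler_nat R) -natr1 => hj; split; lra.
Qed.

Lemma absz_succ_le (k : int) : (`|(k + 1)%R| <= `|k|.+1)%N.
Proof. by lia. Qed.

(* The leftmost of the mirror images [0] and [k + 1] is a lower end from which
   every estimate propagates to the right, whatever the sign of [k]. *)
Lemma mirror_pair (k : int) : let L := `|(k + 1)%R|%N in
  exists i : int,
    [/\ (i = 0 /\ i + L%:Z = k + 1) \/ (i = k + 1 /\ i + L%:Z = 0),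
      k + 1 = i + (i + L%:Z), i * 2 <= k + 1, k - i * 2 <= `|k| &
      (i + L%:Z) * 2 <= k + 2 + `|k|].
Proof.
by case: (lerP 0 (k + 1)) => k0; [exists 0|exists (k + 1)]; split; lia.
Qed.

(** One copy of [d] bounds the error of the reflection estimate, the other bounds the vector at
    [k + 1]. *)
Lemma reflective_origin_small (R : realType) (r B S d : R) (om : R[i])
    (al : int -> R[i]) (z : int -> R[i] * R[i]) :
  0 <= r -> r < 1 -> 4 * szego_const r + 1 <= B -> cabs om = 1 ->
  (forall n, cabs (al n) <= r) ->
  (forall n, z (n + 1) = szego om (al n) (z n)) ->
  sums_le (fun n => nrm (z n) ^+ 2) S -> reflective B al -> 0 < d ->
  cabs (z 0).1 ^+ 2 <= d + d /\ cabs (z 0).2 ^+ 2 <= d + d.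
Proof.
move=> r0 r1 hB ho ha hz hS hrefl d0.
have K4 := szego_const_ge4 r0 r1.
set K := szego_const r in K4 hB *.
have S0 : 0 <= S by have := hS [::] isT; rewrite big_nil.
(* Chosen so that [t > T] yields [4 * K ^+ 3 * S <= d * (1 + t / 2)]. *)
set T := 8 * K ^+ 3 * S / d.
(* Of the infinitely many reflection centres, only finitely many have [|k| <= T] or a large vector
   at [k + 1]. *)
have [k [hk kT kd]] : exists k : int, [/\ reflective_at B k al,
    T < `|k|%N%:R & nrm (z (k + 1)) ^+ 2 < d].
  apply: contrapT => hno; apply: hrefl.
  have hS1 : sums_le (fun n => nrm (z (n + 1)) ^+ 2) S.
    by apply: (sums_le_inj (h := fun n : int => n + 1) _ hS) => u v; lia.
  have f2 := sums_le_finite d0 hS1.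
  have f1 : finite_set [set k : int | (`|k| <= Num.truncn T)%N].
    set N := Num.truncn T.
    have f : finite_set (Posz @` `I_N.+1 `|` Negz @` `I_N.+1).
      by rewrite finite_setU; split; apply: finite_image; apply: finite_II.
    apply: sub_finite_set f => -[n|n] /= hn; [left|right]; exists n => //=.
    by lia.
  have f3 := conj f1 f2; rewrite -finite_setU in f3.
  apply: sub_finite_set f3 => k hk.
  have [kT|kT] := ltP T (`|k|%N%:R); last first.
    left => /=; rewrite Num.Theory.truncn_ge_nat// (le_trans _ kT)//.
  right => /=; rewrite leNgt; apply/negP => kd; apply: hno; exists k.
  by split.
set e := expR (- B * `|half_integer R k|).
set H := expR (B * `|half_integer R k|).
have eH : e * H = 1 by rewrite /e /H mulNr expRN mulVf// gt_eqF// expR_gt0.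
have e0 : 0 < e by exact: expR_gt0.
have H0 : 0 < H by exact: expR_gt0.
set M := Num.truncn H.
have hM1 : M%:R <= H by have /andP[] := Num.Theory.truncn_itv (ltW H0).
have hM : 1 <= M.+1%:R * e.
  rewrite -[leLHS]eH mulrC; apply: ler_wpM2r; first exact: ltW.
  exact/ltW/Num.Theory.truncnS_gt.
set L := `|(k + 1)%R|%N.
set X := (2 * K) ^+ L * (2 * K ^+ 2 * S * e).
set t : R := `|k|%N%:R in kT.
have t0 : 0 <= t by exact: ler0n.
have hX : X <= d.
  have ht : `|half_integer R k| = t / 2.
    by rewrite /half_integer normrM -intr_norm normfV (ger0_norm (_ : 0 <= 2)).
  set q := expR (- (t / 2)).
  have q0 : 0 < q by exact: expR_gt0.
  have q1 : q * (1 + t / 2) <= 1.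
    apply: (@le_trans _ _ (q * expR (t / 2))).
      by apply: ler_wpM2l; [exact: ltW|exact: expR_ge1Dx].
    by rewrite /q expRN mulVf// gt_eqF// expR_gt0.
  (* The origin of the threshold: [2 K |k| - B |k| / 2 <= - |k| / 2] as soon as [B >= 4 K + 1]. *)
  have heq : expR (2 * K) ^+ `|k|%N * e <= q.
    rewrite -expRM_natl -expRD ler_expR ht -/t.
    have : 0 <= (B - (4 * K + 1)) * t by rewrite mulr_ge0// subr_ge0.
    by lra.
  have hL : (2 * K) ^+ L <= 2 * K * expR (2 * K) ^+ `|k|%N.
    apply: (@le_trans _ _ ((2 * K) ^+ `|k|%N.+1)).
      by rewrite ler_weXn2l//; [lra|exact: absz_succ_le].
    rewrite exprS ler_wpM2l//; first by lra.
    rewrite lerXn2r ?nnegrE ?expR_ge0//; first by lra.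
    by have := expR_ge1Dx (2 * K); lra.
  have Xq : X <= 4 * K ^+ 3 * S * q.
    apply: (@le_trans _ _ (2 * K * expR (2 * K) ^+ `|k|%N *
        (2 * K ^+ 2 * S * e))).
      apply: ler_wpM2r => //; apply: mulr_ge0 (ltW e0).
      by apply: mulr_ge0 S0; apply: mulr_ge0 (sqr_ge0 _).
    have -> : 2 * K * expR (2 * K) ^+ `|k|%N * (2 * K ^+ 2 * S * e) =
      4 * K ^+ 3 * S * (expR (2 * K) ^+ `|k|%N * e) by ring.
    apply: ler_wpM2l => //; apply: mulr_ge0 S0; apply: mulr_ge0 => //.
    by apply: exprn_ge0; lra.
  apply: (le_trans Xq).
  have : 4 * K ^+ 3 * S <= d * (1 + t / 2).
    by move: kT; rewrite /T ltr_pdivrMr//; lra.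
  move=> /(ler_wpM2r (ltW q0)) /le_trans; apply.
  by rewrite -mulrA [_ * q]mulrC ler_piMr// ltW.
have [i [hi iL h1 h2 h3]] := mirror_pair k.
rewrite -/L in hi iL h3.
have [g1 g2] := reflection_estimate r0 r1 ho ha hz hS iL
  (fun j hj => reflective_at_near (ltac:(lra) : 1 <= B) hk h1 h2 h3 hM1 hj)
  (ltW e0) hM.
rewrite -/K -/X in g1 g2.
have [a1 a2] : cabs ((z 0).1 ^+ 2 + (z (k + 1)).2 ^+ 2) <= X /\
    cabs ((z 0).2 ^+ 2 + (z (k + 1)).1 ^+ 2) <= X.
  by case: hi => -[hi hL]; move: g1 g2; rewrite hL hi// => g1 g2; split;
    rewrite addrC.
have n1 := cabs_ge0 (z (k + 1)).1; have n2 := cabs_ge0 (z (k + 1)).2.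
split.
  rewrite expr2 -cabsM -expr2 -[_ ^+ 2](addrK ((z (k + 1)).2 ^+ 2)).
  rewrite (le_trans (le_cabsB _ _))// lerD ?(le_trans a1)//.
  by rewrite expr2 cabsM; move: kd; rewrite /nrm; nra.
rewrite expr2 -cabsM -expr2 -[_ ^+ 2](addrK ((z (k + 1)).1 ^+ 2)).
rewrite (le_trans (le_cabsB _ _))// lerD ?(le_trans a2)//.
by rewrite expr2 cabsM; move: kd; rewrite /nrm; nra.
Qed.

(** * From CMV eigenvectors to the recursion *)

(** Admissibility makes the block with rows [(al^*, rh)] and [(rh^*, - al)] unitary. *)
Lemma theta_isometry (R : realType) (al rh x y : R[i]) :
  cabs al ^+ 2 + cabs rh ^+ 2 = 1 ->
  cabs (al^* * x + rh * y) ^+ 2 + cabs (rh^* * x - al * y) ^+ 2 =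
    cabs x ^+ 2 + cabs y ^+ 2.
Proof.
move=> h; apply: complexI; rewrite !rmorphD /= !sqr_cabs.
have {}h : al * al^* + rh * rh^* = 1.
  by rewrite -!sqr_cabs -rmorphD h.
rewrite conjB conjD !conjM !conjCK.
transitivity ((al * al^* + rh * rh^*) * (x * x^* + y * y^*)); first by ring.
by rewrite h mul1r.
Qed.

(** * Comparison of finite sums under reindexing *)

Lemma le_sum_uniq (R : realType) (I : eqType) (f : I -> R) (s s' : seq I) :
  (forall n, 0 <= f n) -> uniq s -> uniq s' -> {subset s <= s'} ->
  \sum_(n <- s) f n <= \sum_(n <- s') f n.
Proof.
move=> f0 us us' sub.
have -> : \sum_(n <- s) f n = \sum_(n <- s' | n \in s) f n.
  rewrite -[RHS]big_filter; apply/perm_big/uniq_perm.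
  1,2: by rewrite ?filter_uniq.
  move=> n.
  by rewrite mem_filter andb_idr//; exact: sub.
by rewrite [leRHS](bigID (mem s))/= lerDl sumr_ge0.
Qed.

(** The sums of [f] over [s] and of [g] over the image of [s] both sit inside sums over the union of
    [s] and its image. *)
Lemma sums_leD_inj (R : realType) (I : eqType) (f g : I -> R) (S : R)
    (h : I -> I) :
  injective h -> (forall n, 0 <= f n) -> (forall n, 0 <= g n) ->
  sums_le (fun n => f n + g n) S -> sums_le (fun n => f n + g (h n)) S.
Proof.
move=> hi f0 g0 hS s us.
apply: le_trans (hS _ (undup_uniq (s ++ map h s))).
rewrite !big_split/= lerD//.
  by apply: le_sum_uniq; rewrite ?undup_uniq// => n ns;
    rewrite mem_undup mem_cat ns.
rewrite -(big_map h predT g).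
apply: le_sum_uniq; rewrite ?undup_uniq ?map_inj_uniq// => n ns.
by rewrite mem_undup mem_cat ns orbT.
Qed.

Lemma sums_leZ (R : realType) (I : eqType) (f g : I -> R) (S t : R) :
  0 <= t -> (forall n, f n <= t * g n) -> sums_le g S -> sums_le f (t * S).
Proof.
move=> t0 fg hS s us.
apply: (@le_trans _ _ (\sum_(n <- s) t * g n)); first exact: ler_sum.
by rewrite -mulr_sumr ler_wpM2l// hS.
Qed.

Lemma sums_leD (R : realType) (I : eqType) (f g : I -> R) (S T : R) :
  sums_le f S -> sums_le g T -> sums_le (fun n => f n + g n) (S + T).
Proof. by move=> hS hT s us; rewrite big_split/= lerD ?hS ?hT. Qed.

Lemma sums_le_inf (R : realType) (I : eqType) (f : I -> R) :
  (exists S, sums_le f S) -> sums_le f (inf [set S | sums_le f S]).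
Proof. by move=> hS s us; apply: lb_le_inf => // S; apply. Qed.

(** * Scattering form, gauge and transfer recursion *)

(** The unitary block at [n] sends [(a n, b (n + 1))] to [om] times [(b n, a (n + 1))], in the same
    form for both parities of [n]. *)
Definition scattering (R : realType) (om : R[i]) (al rh a b : int -> R[i]) :
    Prop :=
  forall n, om * b n = (al n)^* * a n + rh n * b (n + 1) /\
    om * a (n + 1) = (rh n)^* * a n - al n * b (n + 1).

(* Each scattering block is isometric, so the best constant [T] with
   [sums_le (|a|^2 + |b|^2) T] satisfies both [T <= |om|^2 T] and
   [|om|^2 T <= T]. *)
Lemma scattering_unimodular (R : realType) (om : R[i]) (al rh a b : int -> R[i])
    (S : R) (n0 : int) :
  admissible al rh -> scattering om al rh a b ->
  sums_le (fun n => cabs (a n) ^+ 2 + cabs (b n) ^+ 2) S ->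
  0 < cabs (a n0) ^+ 2 + cabs (b n0) ^+ 2 -> cabs om = 1.
Proof.
move=> hadm hsc hS hn0.
pose A n := cabs (a n) ^+ 2; pose B n := cabs (b n) ^+ 2.
have A0 n : 0 <= A n by exact: sqr_ge0.
have B0 n : 0 <= B n by exact: sqr_ge0.
have comm (f g : int -> R) T : sums_le (fun n => f n + g n) T ->
    sums_le (fun n => g n + f n) T.
  move=> h s us; apply: le_trans (h s us).
  by rewrite le_eqVlt; apply/orP; left; apply/eqP/eq_bigr => n _; exact: addrC.
have hi : injective (fun n : int => n + 1) by move=> u v; lia.
have hi' : injective (fun n : int => n - 1) by move=> u v; lia.
set t := cabs om ^+ 2.
have t0 : 0 <= t by exact: sqr_ge0.
have key n : A n + B (n + 1) = t * (B n + A (n + 1)).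
  have [h1 h2] := hsc n.
  rewrite /A /B -(theta_isometry (a n) (b (n + 1)) (hadm n)) -h1 -h2 !cabsM.
  by rewrite /t; ring.
have unshift (f g : int -> R) T :
    (forall n, 0 <= f n) -> (forall n, 0 <= g n) ->
    sums_le (fun n => f n + g (n + 1)) T -> sums_le (fun n => f n + g n) T.
  move=> f0 g0 h.
  have := sums_leD_inj hi' f0 (fun n => g0 (n + 1)) h.
  by under eq_fun do rewrite subrK.
pose s n := A n + B n.
set T := inf [set T | sums_le s T].
have hT : sums_le s T by apply: sums_le_inf; exists S.
have T0 : 0 < T by exact: lt_le_trans hn0 (sums_le1 n0 hT).
have Tle T' : sums_le s T' -> T <= T'.
  move=> h; apply: ge_inf => //; exists 0 => T1 /(_ [::] isT).
  by rewrite big_nil.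
have T1 : T <= t * T.
  apply: Tle; apply: (unshift _ _ _ A0 B0).
  apply: (sums_leZ t0 (g := fun n => B n + A (n + 1))).
    by move=> n; rewrite key.
  by apply: (sums_leD_inj hi) => //; exact: comm.
have t1 : 1 <= t by rewrite -(ler_pM2r T0) mul1r.
have T2 : T <= t^-1 * T.
  apply: Tle; apply: comm; apply: (unshift _ _ _ B0 A0).
  apply: (sums_leZ _ (g := fun n => A n + B (n + 1))).
    by rewrite invr_ge0.
    by move=> n; rewrite key mulKf//; lra.
  exact: (sums_leD_inj hi).
have t2 : t <= 1.
  by rewrite -(ler_pM2r T0) mul1r -ler_pdivlMl//; lra.
have := cabs_ge0 om; rewrite /t in t1 t2; nra.
Qed.

Lemma int_recursion (F : fieldType) (c : int -> F) :
  (forall n, c n != 0) ->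
  exists2 g : int -> F, g 0 = 1 & forall n, g (n + 1) = g n * c n.
Proof.
move=> c0; pose g (n : int) := match n with
  | Posz m => \prod_(j < m) c j%:Z
  (* [Negz m] is [- (m + 1)], hence [m.+1] inverse factors, from [c (-1)] down to [c (- m - 1)]. *)
  | Negz m => \prod_(j < m.+1) (c (Negz j))^-1 end.
exists g; first by rewrite /= big_ord0.
case=> [m|[|m]].
- have -> : Posz m + 1 = Posz m.+1 by lia.
  by rewrite /= big_ord_recr.
- have -> : Negz 0 + 1 = Posz 0 by lia.
  by rewrite /= big_ord0 big_ord1 mulVf.
- have -> : Negz m.+1 + 1 = Negz m by lia.
  by rewrite /= [in RHS]big_ord_recr/= divfK.
Qed.

(** The gauge accumulates the phases [rh n / |rh n|], so that only the moduli of [rh] survive. *)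
Lemma gauge_exists (R : realType) (rh : int -> R[i]) :
  (forall n, rh n != 0) ->
  exists g : int -> R[i], forall n, cabs (g n) = 1 /\
    g (n + 1) * (cabs (rh n))%:C = g n * rh n.
Proof.
move=> rh0.
have m0 n : cabs (rh n) != 0.
  by apply: contra (rh0 n) => /eqP/cabs0_eq0 ->.
have m0C n : (cabs (rh n))%:C != 0.
  by apply: contra (m0 n) => /eqP h; apply/eqP; apply: complexI.
have [|g g1 hg] := @int_recursion _ (fun n => rh n / (cabs (rh n))%:C).
  by move=> n; rewrite mulf_neq0// invr_eq0.
exists g => n; split; last by rewrite hg -mulrA divfK.
have hc k : cabs (g (k + 1)) = cabs (g k).
  rewrite hg cabsM [cabs (_ / _)](_ : _ = 1) ?mulr1//.
  by apply: (mulIf (m0 k)); rewrite mul1r -{2}(cabs_real (cabs_ge0 (rh k)))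
    -cabsM divfK.
elim/int_rect: n => [|n IH|n IH].
- by rewrite g1 /cabs Normc.normc1.
- by rewrite -addn1 PoszD hc.
- by rewrite -hc; have -> : - n.+1%:Z + 1 = - n%:Z by lia.
Qed.

(** Wronskians with the two basis vectors read off the coordinates, and the transfer matrix
    preserves them. *)
Lemma szego_eq0 (R : realType) (om al : R[i]) (x : R[i] * R[i]) :
  cabs om = 1 -> cabs al < 1 -> szego om al x = (0, 0) -> x = (0, 0).
Proof.
move=> ho ha hx; have W y := wronskian_szego x y ho ha.
rewrite hx /wronskian /= in W.
case: x hx W => x1 x2 _ /= W; congr pair.
  by transitivity (x1 * 1 - x2 * 0); [ring|rewrite -(W (0, 1)); ring].
by transitivity (- (x1 * 0 - x2 * 1)); [ring|rewrite -(W (1, 0)); ring].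
Qed.

(** Solving the block for the amplitudes at [n + 1] divides by [rh n]; the gauge turns this into
    division by [|rh n|], which is [cfac (al n)]. *)
Lemma scattering_szego (R : realType) (om : R[i]) (al rh a b g : int -> R[i])
    (n : int) :
  admissible al rh -> scattering om al rh a b -> cabs om = 1 -> rh n != 0 ->
  g (n + 1) * (cabs (rh n))%:C = g n * rh n ->
  (g (n + 1) * a (n + 1), g (n + 1) * b (n + 1)) =
    szego om (al n) (g n * a n, g n * b n).
Proof.
move=> hadm /(_ n) [h1 h2] ho hr hg.
have m0 : cabs (rh n) != 0 by apply: contra hr => /eqP/cabs0_eq0 ->.
have hc : cfac (al n) = (cabs (rh n))^-1.
  rewrite /cfac -(hadm n) addrAC subrr add0r sqrtr_sqr ger0_norm//.
  exact: cabs_ge0.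
have m0C : (cabs (rh n))%:C != 0.
  by apply: contra m0 => /eqP h; apply/eqP; apply: complexI.
have ho' := unimodular_conjM ho.
have hadmC : al n * (al n)^* + rh n * (rh n)^* = 1.
  by rewrite -!sqr_cabs -rmorphD/= hadm.
rewrite /szego /= hc fmorphV/=; congr pair; apply: (mulIf m0C).
  rewrite mulrAC hg [RHS]mulrAC mulVf// mul1r.
  transitivity (g n * (om^* * (rh n * (om * a (n + 1))))).
    by transitivity (g n * rh n * a (n + 1) * (om * om^*));
      [rewrite ho' mulr1|ring].
  rewrite h2.
  (* Unitarity trades [b (n + 1)] for [om * b n]. *)
  have -> : rh n * ((rh n)^* * a n - al n * b (n + 1)) =
      (al n * (al n)^* + rh n * (rh n)^*) * a n -
      al n * ((al n)^* * a n + rh n * b (n + 1)) by ring.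
  rewrite hadmC -h1.
  transitivity (om^* * (g n * a n) - al n * (g n * b n) * (om * om^*)).
    by ring.
  by rewrite ho' mulr1.
rewrite mulrAC hg [RHS]mulrAC mulVf// mul1r.
transitivity (g n * (om * b n - (al n)^* * a n)); last by ring.
by rewrite h1; ring.
Qed.

Lemma reflective_scattering_eq0 (R : realType) (r B S : R) (om : R[i])
    (al rh a b : int -> R[i]) :
  0 <= r -> r < 1 -> 4 * szego_const r + 1 <= B ->
  (forall n, cabs (al n) <= r) -> admissible al rh ->
  scattering om al rh a b ->
  sums_le (fun n => cabs (a n) ^+ 2 + cabs (b n) ^+ 2) S ->
  reflective B al -> forall n, a n = 0 /\ b n = 0.
Proof.
move=> r0 r1 hB ha hadm hsc hS hrefl n0.
(* Only a nonzero amplitude reveals that [om] is unimodular; a vanishing pair is already the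
   claim. *)
have [h0|h0] := ltP 0 (cabs (a n0) ^+ 2 + cabs (b n0) ^+ 2); last first.
  have [p1 p2] := (sqr_ge0 (cabs (a n0)), sqr_ge0 (cabs (b n0))).
  by split; apply: cabs0_eq0; apply/eqP; rewrite -sqrf_eq0; apply/eqP; lra.
have ho := scattering_unimodular hadm hsc hS h0.
have rh0 n : rh n != 0.
  apply/eqP => h; have := hadm n; rewrite h cabs0.
  by have := ha n; have := cabs_ge0 (al n); nra.
have [g hg] := gauge_exists rh0.
pose z n := (g n * a n, g n * b n).
have hz n : z (n + 1) = szego om (al n) (z n).
  by have [_ hgn] := hg n; exact: scattering_szego hadm hsc ho (rh0 n) hgn.
have hzS : sums_le (fun n => nrm (z n) ^+ 2) (2 * S).
  apply: (sums_leZ _ _ hS) => // n.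
  have [g1 _] := hg n; rewrite /nrm /= !cabsM g1 !mul1r.
  by have := sqr_ge0 (cabs (a n) - cabs (b n)); nra.
have zero x : (forall d : R, 0 < d -> cabs x ^+ 2 <= d + d) -> x = 0 :> R[i].
  move=> h; apply: cabs0_eq0; apply/eqP; rewrite -sqrf_eq0 eq_le sqr_ge0 andbT.
  rewrite leNgt; apply/negP => p; have := h (cabs x ^+ 2 / 4); lra.
have z0 : z 0 = (0, 0).
  have h d (d0 : 0 < d) :=
    reflective_origin_small r0 r1 hB ho ha hz hzS hrefl d0.
  by congr pair; apply: zero => d /h[].
have ha1 n : cabs (al n) < 1 by exact: le_lt_trans (ha n) r1.
have zn n : z n = (0, 0).
  elim/int_rect: n => [//|n IH|n IH].
    by rewrite -addn1 PoszD hz IH /szego /= !mulr0 subr0 mulr0.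
  apply: (szego_eq0 ho (ha1 (- n.+1%:Z))); rewrite -hz.
  by have -> : - n.+1%:Z + 1 = - n%:Z by lia.
have g0 : g n0 != 0.
  apply/eqP => g0; have [/esym/eqP + _] := hg n0.
  by rewrite g0 cabs0 oner_eq0.
have [/eqP + /eqP] := zn n0.
by rewrite !mulf_eq0 (negbTE g0) /= => /eqP -> /eqP ->.
Qed.

Lemma l2Z_sums_le (R : realType) (u : int -> R[i]) : l2Z u ->
  exists S, sums_le (fun n => cabs (u n) ^+ 2) S.
Proof.
rewrite /l2Z /= => hu; have := hu; rewrite summableE => /fineK hS.
exists (fine (\esum_(x in [set: int]) `|(cabs (u x) ^+ 2)%:E|)%E) => s us.
rewrite -lee_fin hS.
apply: ereal_sup_ubound => /=.
exists [set` s]; first by split => //; exact: finite_seq.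
rewrite -fsbig_seq// -sumEFin; apply: eq_bigr => n _.
by rewrite /= ger0_norm// sqr_ge0.
Qed.

(** These are the two brackets in the formula of [gecmv]: its inner factor, with blocks on the sites
    [n], [n + 1] for odd [n]. *)
Definition cmv_inner (R : realType) (al rh u : int -> R[i]) (n : int) : R[i] :=
  if (2 %| n)%Z then (rh (n - 1))^* * u (n - 1) - al (n - 1) * u n
  else (al n)^* * u n + rh n * u (n + 1).

Lemma cmv_inner_isometry (R : realType) (al rh u : int -> R[i]) (n : int) :
  admissible al rh -> ~~ (2 %| n)%Z ->
  cabs (cmv_inner al rh u n) ^+ 2 + cabs (cmv_inner al rh u (n + 1)) ^+ 2 =
    cabs (u n) ^+ 2 + cabs (u (n + 1)) ^+ 2.
Proof.
move=> hadm hn; rewrite /cmv_inner (negbTE hn).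
have -> : (2 %| n + 1)%Z by lia.
by rewrite addrK theta_isometry.
Qed.

Lemma cmv_inner_le (R : realType) (al rh u : int -> R[i]) (n : int) :
  admissible al rh ->
  cabs (cmv_inner al rh u n) ^+ 2 <=
    cabs (u (n - 1)) ^+ 2 + (cabs (u n) ^+ 2 + cabs (u (n + 1)) ^+ 2).
Proof.
move=> hadm; have [hn|hn] := boolP (2 %| n)%Z.
  have hn' : ~~ (2 %| n - 1)%Z by lia.
  have := cmv_inner_isometry u hadm hn'; rewrite subrK.
  have := (sqr_ge0 (cabs (cmv_inner al rh u (n - 1))),
    sqr_ge0 (cabs (u (n + 1)))).
  by move=> [p q] h; lra.
have := cmv_inner_isometry u hadm hn.
have := (sqr_ge0 (cabs (cmv_inner al rh u (n + 1))),
  sqr_ge0 (cabs (u (n - 1)))).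
by move=> [p q] h; lra.
Qed.

(* [gecmv] is the product of two direct sums of 2x2 blocks, on the sites
   [n, n + 1] with [n] even and with [n] odd respectively; with [om ^+ 2] as
   the eigenvalue the two factors enter symmetrically. *)
Lemma gecmv_scattering (R : realType) (om : R[i]) (al rh u : int -> R[i]) :
  (forall n, gecmv al rh u n = om ^+ 2 * u n) ->
  let v := cmv_inner al rh u in
  scattering om al rh (fun n => if (2 %| n)%Z then v n else om * u n)
    (fun n => if (2 %| n)%Z then om * u n else v n).
Proof.
move=> hE v n.
(* At odd [n] both equations are the definition of [v] times [om]; at even [n] they are the
   eigenvalue equation. *)
have [hn|hn] := boolP (2 %| n)%Z; last first.
  have hn1 : (2 %| n + 1)%Z by lia.
  by rewrite hn1 /v /cmv_inner (negbTE hn) hn1 addrK; split; ring.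
have hn1 : (2 %| n + 1)%Z = false by lia.
have [m nm] : exists m, n = 2 * m by exists (n %/ 2)%Z; lia.
have h1 := gecmv_even al rh u m; have h2 := gecmv_odd al rh u m.
have e1 : v (2 * m) = (rh (2 * m - 1))^* * u (2 * m - 1) -
    al (2 * m - 1) * u (2 * m) by rewrite /v /cmv_inner -nm hn.
have e2 : v (2 * m + 1) = (al (2 * m + 1))^* * u (2 * m + 1) +
    rh (2 * m + 1) * u (2 * m + 2).
  rewrite /v /cmv_inner -nm hn1; congr (_ + _ * u _); lia.
rewrite hn1 nm; move: h1 h2; rewrite !hE => h1 h2.
by rewrite !mulrA -!expr2 h1 h2 e1 e2.
Qed.

Lemma point_spectrum_gecmv (R : realType) (r B : R) (al rh : int -> R[i]) :
  0 <= r -> r < 1 -> 4 * szego_const r + 1 <= B ->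
  (forall n, cabs (al n) <= r) -> reflective B al -> admissible al rh ->
  point_spectrum (gecmv al rh) = set0.
Proof.
move=> r0 r1 hB ha hrefl hadm; rewrite -subset0 => w [u [hu [n0 un0] hE]].
have hE' n : gecmv al rh u n = sqrtc w ^+ 2 * u n by rewrite sqr_sqrtc.
have hsc := gecmv_scattering hE'; rewrite /= in hsc.
set om := sqrtc w in hsc; set v := cmv_inner al rh u in hsc.
have [S hS] := l2Z_sums_le hu.
have hSp : sums_le (fun n => cabs (u (n + 1)) ^+ 2) S.
  by apply: (sums_le_inj (h := fun n : int => n + 1) _ hS) => x y; lia.
have hSm : sums_le (fun n => cabs (u (n - 1)) ^+ 2) S.
  by apply: (sums_le_inj (h := fun n : int => n - 1) _ hS) => x y; lia.
have hv : sums_le (fun n => cabs (v n) ^+ 2) (1 * (S + (S + S))).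
  apply: sums_leZ (sums_leD hSm (sums_leD hS hSp)) => // n.
  by rewrite mul1r cmv_inner_le.
have hou : sums_le (fun n => cabs (om * u n) ^+ 2) (cabs om ^+ 2 * S).
  by apply: sums_leZ hS; rewrite ?sqr_ge0// => n; rewrite cabsM exprMn.
have hab := reflective_scattering_eq0 r0 r1 hB ha hadm hsc.
have {}hab := hab (1 * (cabs om ^+ 2 * S + 1 * (S + (S + S)))) _ hrefl.
have v0 n : v n = 0.
  have [] := hab _ n.
    apply: (sums_leZ _ _ (sums_leD hou hv)) => // k.
    by rewrite mul1r; case: ifP => _ //; rewrite addrC.
  by case: ifP => _ //.
(* The odd blocks are isometric, so [v = 0] already gives [u = 0] without dividing by [om]. *)
have u0 n : ~~ (2 %| n)%Z -> u n = 0 /\ u (n + 1) = 0.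
  move=> hn; have := cmv_inner_isometry u hadm hn; rewrite -/v !v0 cabs0.
  have := (sqr_ge0 (cabs (u n)), sqr_ge0 (cabs (u (n + 1)))) => -[p q] h.
  by split; apply: cabs0_eq0; apply/eqP; rewrite -sqrf_eq0; apply/eqP; lra.
move/eqP: un0; apply.
have [hn|hn] := boolP (2 %| n0)%Z; last by have [] := u0 _ hn.
have hn' : ~~ (2 %| n0 - 1)%Z by lia.
by have [_] := u0 _ hn'; rewrite subrK.
Qed.

Local Open Scope complex_scope.

Theorem theorem2p2 (R : realType) (r0 : R) (hr0 : r0 < 1) :
  exists B0 : R,
  forall alpha : int -> R[i],
    (forall n, cabs (alpha n) < 1) ->
    sup (range (fun n => cabs (alpha n))) = r0 ->
  forall B : R, 0 < B -> B0 < B -> reflective B alpha ->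
    (forall rho : int -> R[i], admissible alpha rho ->
       point_spectrum (gecmv alpha rho) = set0) /\
    point_spectrum (cmv alpha) = set0.
Proof.
exists (4 * szego_const r0 + 1) => alpha ha1 hsup B _ hB hrefl.
(* The range is bounded by 1, so its [sup] is a genuine upper bound. *)
have ha n : cabs (alpha n) <= r0.
  rewrite -hsup; apply: ub_le_sup; last by exists n.
  by exists 1 => _ [m _ <-]; exact: ltW.
have r00 : 0 <= r0 by exact: le_trans (cabs_ge0 _) (ha 0).
have main rho : admissible alpha rho ->
    point_spectrum (gecmv alpha rho) = set0.
  exact: point_spectrum_gecmv r00 hr0 (ltW hB) ha hrefl.
split => //; apply: main => n.
have h0 := cabs_ge0 (alpha n); have h1 := ha1 n.
by rewrite cabs_real ?sqrtr_ge0// sqr_sqrtr; [ring|nra].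
Qed.
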